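(* Let $H$ be a complex Hilbert space, $T\in B(H)$ and $M$ a closed subspace of $H$. Assume $M$ is $T$-almost invariant. Then, for a finite rank operator $T_0\in B(H)$, $M$ is $(T+T_0)$-invariant if and only if $$T_0=-(I-P_M)TP_M+\sum_{i=1}^{k}x_i\otimes y_i+\sum_{j=1}^{m}u_j\otimes v_j$$ for some (arbitrary) finite families $x_i\in M$, $y_i\in H$, $u_j\in H$, $v_j\in M^\perp$. Similarly, assume $M$ is $T$-almost reducing. Then, for a finite rank operator $T_0\in B(H)$, $M$ is $(T+T_0)$-reducing if and only if $$T_0=-(I-P_M)TP_M-P_MT(I-P_M)+\sum_{i=1}^{k}x_i\otimes y_i+\sum_{j=1}^{m}u_j\otimes v_j$$ for some (arbitrary) finite families $x_i,y_i\in M$ and $u_j,v_j\in M^\perp$.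
   Context: $B(H)$ is the algebra of bounded operators on $H$; $P_M$ is the orthogonal projection onto $M$; $(x\otimes y)h=\langle h,y\rangle x$. $M$ is $A$-invariant if $AM\subset M$, and $A$-reducing if both $M$ and $M^\perp$ are $A$-invariant. $M$ is $T$-almost invariant if there is a finite-dimensional subspace $W$ with $TM\subset M+W$; $M$ is $T$-almost reducing if both $M$ and $M^\perp$ are $T$-almost invariant (equivalently, $M$ is almost invariant for both $T$ and $T^*$). *)

(* Defs.v *)
From HB Require Import structures.
From mathcomp Require Import all_boot all_order all_algebra.
From mathcomp Require Import complex.
From mathcomp Require Import all_classical all_reals.
From mathcomp Require Import topology normedtype.

Set Implicit Arguments.
Unset Strict Implicit.
Unset Printing Implicit Defensive.

Import Order.TTheory GRing.Theory Num.Theory.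
Import numFieldNormedType.Exports.

Local Open Scope classical_set_scope.
Local Open Scope ring_scope.

(* The inner product is linear in its first argument and conjugate-linear in
   the second. *)
HB.mixin Record CompleteNormedModule_isHilbert (R : realType) H
    & CompleteNormedModule R[i] H := {
  inner : {dot H for (@Num.conj R[i])} ;
  inner_norm : forall x : H, `|x| ^+ 2 = inner x x
}.

#[short(type="hilbertType")]
HB.structure Definition Hilbert (R : realType) :=
  {H of CompleteNormedModule R[i] H & CompleteNormedModule_isHilbert R H}.

Section HilbertOperators.
Context {R : realType} {H : hilbertType R}.
Implicit Types (A : H -> H) (M W : set H) (x y : H).

(* Equivalent, by [linear_boundedP], to the existence of a constant c such that
   `|A x| <= c * `|x| for all x. *)
Definition bounded_operator (A : {linear H -> H}) : Prop :=
  bounded_near A (nbhs (0 : H)).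

Definition closed_subspace M : Prop := submod_closed [in M] /\ closed M.

Definition finite_dim W : Prop :=
  exists (n : nat) (w : 'I_n -> H),
    W = [set \sum_(i < n) c i *: w i | c in [set: 'I_n -> R[i]]].

Definition finite_rank A : Prop := finite_dim (range A).

Definition orthocompl M : set H :=
  [set x | forall z, M z -> inner x z = 0].

(* For a closed subspace M, the projection theorem says that exactly one point
   satisfies the predicate; the default value 0 is then irrelevant. *)
Definition orthoproj M : H -> H :=
  fun x => xget 0 [set p | M p /\ orthocompl M (x - p)].

Definition rank_one x y : H -> H := fun h => inner h y *: x.

Definition invariant_subspace A M : Prop := A @` M `<=` M.

Definition reducing_subspace A M : Prop :=
  invariant_subspace A M /\ invariant_subspace A (orthocompl M).

Definition almost_invariant A M : Prop :=
  exists2 W, finite_dim W & A @` M `<=` [set u + w | u in M & w in W].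

Definition almost_reducing A M : Prop :=
  almost_invariant A M /\ almost_invariant A (orthocompl M).

End HilbertOperators.

Notation "x \otimes y" := (rank_one x y)
  (at level 40, left associativity) : ring_scope.

(* Main.v *)
Require Import Defs.
From HB Require Import structures.
From mathcomp Require Import all_boot all_order all_algebra.
From mathcomp Require Import complex.
From mathcomp Require Import all_classical all_reals.
From mathcomp Require Import topology normedtype.
From mathcomp Require Import ring.

Set Implicit Arguments.
Unset Strict Implicit.
Unset Printing Implicit Defensive.

Import Order.TTheory GRing.Theory Num.Theory.
Import numFieldNormedType.Exports.

Local Open Scope classical_set_scope.
Local Open Scope ring_scope.

(** If M is invariant under T + T0, then the block of T0 from M to its
    complement is forced: writing P for the projection onto M and Q = I - P,
    the identity Q (T + T0) P = 0 says Q T0 P = - Q T P.  What remains of T0,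
    namely P T0 + Q T0 Q, is unconstrained, and the only point is to recognise
    these terms as the two families.  A bounded finite-rank operator is a finite
    sum of a_i (x) b_i, and for A linear and B self-adjoint the operator
    A (a (x) b) B is (A a) (x) (B b).  Hence P T0 is a sum of tensors whose left
    factors lie in M, and Q T0 Q a sum of tensors whose right factors lie in
    the orthogonal complement.  When M is reducing, P T0 Q = - P T Q is forced
    as well, and the diagonal blocks P T0 P and Q T0 Q give the two families.
    Conversely, each stated form is substituted into T + T0 and evaluated on M
    and on the orthogonal complement.

    This rests on three classical facts, proved here from completeness.
    [projection_theorem]: the points of M that almost minimise the distance to
    x form a Cauchy filter by the parallelogram law, and a limit p of it
    satisfies x - p _|_ M.  [riesz]: a nonzero bounded functional f is the inner
    product with a multiple of any vector outside ker f that is orthogonal to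
    ker f.  [finite_rank_sum]: the vectors spanning the range are split off one
    at a time, each coefficient being a bounded functional. *)

Section HilbertTheory.
Context {R : realType} {H : hilbertType R}.
Implicit Types (x y z : H) (M : set H).

(** * Inner product geometry *)

(** The term subtracted from x is its projection onto the line through z.  The
    case z = 0 is included because 0^-1 = 0. *)
Lemma sqr_norm_residual x z :
  `|x - (inner x z / `|z| ^+ 2) *: z| ^+ 2 =
  `|x| ^+ 2 - `|inner x z| ^+ 2 / `|z| ^+ 2.
Proof.
have [->|z0] := eqVneq z 0.
  by rewrite scaler0 subr0 normr0 expr0n invr0 mulr0 subr0.
have nz : `|z| ^+ 2 != 0 by rewrite expf_neq0 ?normr_eq0.
rewrite inner_norm dnormB dnormZ linearZr_LR /= -!inner_norm.
set a := inner x z; set N := `|z| ^+ 2 in nz *.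
have Nr : N^* = N by apply/CrealP; rewrite realX ?normr_real.
have NVr : (N^-1)^* = N^-1 by rewrite fmorphV /= Nr.
have N0 : 0 <= N by rewrite /N exprn_ge0.
rewrite normrM normfV (ger0_norm N0) exprMn !rmorphM /= conjCK NVr.
rewrite normCK !NVr.
by field.
Qed.

Lemma inner_le x z : `|inner x z| <= `|x| * `|z|.
Proof.
rewrite -(@ler_pXn2r _ 2) ?nnegrE ?mulr_ge0 // exprMn.
have [->|z0] := eqVneq z 0.
  by rewrite linear0r !normr0 expr0n /= mulr0.
have := exprn_ge0 2 (normr_ge0 (x - (inner x z / `|z| ^+ 2) *: z)).
by rewrite sqr_norm_residual subr_ge0 ler_pdivrMr // exprn_gt0 // normr_gt0.
Qed.

Lemma parallelogram_law x y :
  `|x + y| ^+ 2 + `|x - y| ^+ 2 = 2 * `|x| ^+ 2 + 2 * `|y| ^+ 2.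
Proof. by rewrite !inner_norm dnormD dnormB; ring. Qed.

Lemma innerC x y : inner x y = (inner y x)^*.
Proof. by rewrite hermC /= expr0 mul1r. Qed.

(** * Orthogonal projection onto a closed subspace *)

Lemma submod_lin M : submod_closed [in M] ->
  forall a u v, M u -> M v -> M (a *: u + v).
Proof.
by move=> [_ Mlin] a u v; have := Mlin a u v; rewrite !in_setE => h *; apply: h.
Qed.

Lemma submod0 M : submod_closed [in M] -> M 0.
Proof. by case; rewrite in_setE. Qed.

Lemma submodD M u v : submod_closed [in M] -> M u -> M v -> M (u + v).
Proof. by move=> sM Mu Mv; rewrite -[u]scale1r; exact: submod_lin. Qed.

Lemma submodZ M a u : submod_closed [in M] -> M u -> M (a *: u).
Proof.
move=> sM Mu; rewrite -[_ *: _]addr0.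
by apply: submod_lin => //; exact: submod0.
Qed.

Lemma submod_sum M n (c : 'I_n -> R[i]) (w : 'I_n -> H) :
  submod_closed [in M] -> (forall i, M (w i)) -> M (\sum_(i < n) c i *: w i).
Proof.
move=> sM Mw; elim/big_ind: _ => [|u v|i _]; first exact: submod0.
  exact: submodD.
exact: submodZ.
Qed.

Lemma submod_orthocompl M : submod_closed [in orthocompl M].
Proof.
split=> [|a u v]; rewrite !in_setE; first by move=> z _; rewrite linear0l.
by move=> Mu Mv z Mz; rewrite linearPl /= Mu // Mv // mulr0 addr0.
Qed.

Lemma orthocomplC M x y : orthocompl M x -> M y -> inner y x = 0.
Proof. by move=> Mx My; rewrite innerC Mx // rmorph0. Qed.

(** Norms take their values in R[i], which is only partially ordered; the infimum
    is that of the real parts, the imaginary parts being 0. *)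
Lemma sqdist_infimum M x : M !=set0 ->
  exists d : R[i], (forall m, M m -> d <= `|x - m| ^+ 2) /\
    (forall e : R[i], 0 < e -> exists2 m, M m & `|x - m| ^+ 2 < d + e).
Proof.
move=> [m0 Mm0].
pose E := [set complex.Re (`|x - m| ^+ 2) | m in M].
have lb0 : lbound E 0.
  move=> _ [m _ <-]; have := exprn_ge0 2 (normr_ge0 (x - m)).
  by rewrite lecE => /andP[].
have E0 : E !=set0 by exists (complex.Re (`|x - m0| ^+ 2)), m0.
have Im0 m : complex.Im (`|x - m| ^+ 2) = 0.
  have := exprn_ge0 2 (normr_ge0 (x - m)).
  by rewrite lecE => /andP[/eqP].
exists (inf E)%:C%C; split=> [m Mm|e].
  rewrite lecE /= Im0 eqxx /=; apply: ge_inf; first by exists 0.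
  by exists m.
rewrite ltcE /= => /andP[/eqP Ime Ree].
have [_ [m Mm <-] lt_m] := inf_adherent Ree (conj E0 (ex_intro _ 0 lb0)).
exists m => //; case: e Ime Ree lt_m => er ei /= -> Ree lt_m.
by rewrite ltcE /= Im0 addr0 eqxx.
Qed.

(** Parallelogram law for x - k and x - m: their half-sum is x minus the
    midpoint of k and m, whose squared norm is at least d. *)
Lemma near_minimizers_close M x (d e : R[i]) k m :
    submod_closed [in M] -> (forall m, M m -> d <= `|x - m| ^+ 2) ->
    M k -> M m -> `|x - k| ^+ 2 < d + e -> `|x - m| ^+ 2 < d + e ->
  `|m - k| ^+ 2 < 4 * e.
Proof.
move=> sM dP Mk Mm lt_k lt_m.
have mid : d <= `|x - 2^-1 *: (k + m)| ^+ 2.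
  by apply: dP; apply: submodZ => //; exact: submodD.
have := parallelogram_law (x - k) (x - m).
have -> : x - k + (x - m) = 2 *: (x - 2^-1 *: (k + m)).
  rewrite scalerBr scalerA mulfV ?pnatr_eq0 // scale1r scaler_nat mulr2n.
  by rewrite opprD addrACA.
have -> : x - k - (x - m) = m - k by rewrite opprB addrC addrA subrK.
rewrite normrZ exprMn normr_nat => eq_par.
have -> : `|m - k| ^+ 2 = 2 * `|x - k| ^+ 2 + 2 * `|x - m| ^+ 2
    - 2 ^+ 2 * `|x - 2^-1 *: (k + m)| ^+ 2.
  by rewrite -eq_par addrAC subrr add0r.
have -> : 4 * e = 2 * (d + e) + 2 * (d + e) - 2 ^+ 2 * d by ring.
apply: ltr_leB; last by rewrite ler_pM2l ?exprn_gt0 ?ltr0n.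
by rewrite ltrD // ltr_pM2l.
Qed.

(** Moving m along z to the point closest to x lowers the squared distance by
    |<x - m, z>|^2 / |z|^2, which therefore cannot exceed e. *)
Lemma near_minimizer_orthogonal M x (d e : R[i]) m z :
    submod_closed [in M] -> (forall m, M m -> d <= `|x - m| ^+ 2) ->
    M m -> M z -> z != 0 -> `|x - m| ^+ 2 < d + e ->
  `|inner (x - m) z| ^+ 2 <= e * `|z| ^+ 2.
Proof.
move=> sM dP Mm Mz z0 xm.
have := dP _ (submod_lin sM (inner (x - m) z / `|z| ^+ 2) Mz Mm).
rewrite [_ *: _ + m]addrC opprD addrA sqr_norm_residual => le_d.
rewrite -ler_pdivrMr ?exprn_gt0 ?normr_gt0 // -(lerD2l d).
by apply: ltW; apply: le_lt_trans xm; rewrite -lerBrDr.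
Qed.

(** A limit p of the filter of near-minimizers lies in the closed set M.  Near p
    there are near-minimizers m with <x - m, z> arbitrarily small, and
    <x - p, z> is close to it by Cauchy-Schwarz. *)
Lemma projection_theorem M x : closed_subspace M ->
  exists p, M p /\ orthocompl M (x - p).
Proof.
move=> [sM clM].
have [d [dP d_lt]] := sqdist_infimum x (ex_intro _ 0 (submod0 sM)).
pose F := filter_from [set e : R[i] | 0 < e]
  (fun e => [set m | M m /\ `|x - m| ^+ 2 < d + e]).
have FF : Filter F.
  apply: filter_from_filter; first by exists 1 => /=.
  move=> e1 e2 /= e10 e20; exists (Num.min e1 e2).
    by rewrite /= comparable_lt_min ?e10 ?e20 // real_comparable ?gtr0_real.
  have r12 : (e1 >=< e2)%O by rewrite real_comparable ?gtr0_real.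
  move=> m [Mm lt_m]; split; split=> //; apply: lt_le_trans lt_m _.
    by rewrite lerD2l comparable_ge_min // lexx.
  by rewrite lerD2l comparable_ge_min // lexx orbT.
have PF : ProperFilter F.
  apply: filter_from_proper => e /= e0.
  by have [m Mm lt_m] := d_lt _ e0; exists m.
have cF : cauchy F.
  apply: cauchy_exP => e e0.
  pose e' := e ^+ 2 / 4; have e'0 : 0 < e' by rewrite divr_gt0 // exprn_gt0.
  have [m Mm lt_m] := d_lt _ e'0.
  exists m; exists e' => //= k [Mk lt_k].
  rewrite -ball_normE /= -(@ltr_pXn2r _ 2) ?nnegrE ?normr_ge0 ?(ltW e0) //.
  have -> : e ^+ 2 = 4 * e' by rewrite /e'; field.
  exact: (near_minimizers_close sM dP).
have /cvg_ex[p Fp] : cvg F by exact: cauchy_cvg.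
have near_p e : 0 < e ->
    exists2 m, M m & `|p - m| < e /\ `|x - m| ^+ 2 < d + e ^+ 2.
  move=> e0.
  have Fb : F (ball p e) by apply: Fp; exact: nbhsx_ballx.
  have Fe : F [set m | M m /\ `|x - m| ^+ 2 < d + e ^+ 2].
    by exists (e ^+ 2) => //=; rewrite exprn_gt0.
  have [m []] := filter_ex (filterI Fb Fe).
  by rewrite -ball_normE /= => pm [Mm xm]; exists m.
exists p; split.
  apply: clM => B Bp.
  have FB : F B by exact: Fp.
  have FM : F M by exists 1 => //= m [].
  exact: filter_ex (filterI FM FB).
move=> z Mz.
have [->|z0] := eqVneq z 0; first by rewrite linear0r.
have nz0 : 0 < `|z| by rewrite normr_gt0.
apply/eqP; rewrite -normr_le0.
apply/ler_addgt0Pr => e e0; rewrite add0r.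
pose e' := e / (2 * `|z|); have e'0 : 0 < e' by rewrite divr_gt0 // mulr_gt0.
have [m Mm [pm xm]] := near_p _ e'0.
have -> : x - p = (x - m) - (p - m) by rewrite opprB addrA subrK.
have -> : e = e' * `|z| + e' * `|z| by rewrite /e'; field; rewrite gt_eqF.
rewrite linearBl (le_trans (ler_normB _ _)) // lerD //; last first.
  by rewrite (le_trans (inner_le _ _)) // ler_pM2r // ltW.
rewrite -(@ler_pXn2r _ 2) ?nnegrE ?(mulr_ge0 (ltW e'0)) // exprMn.
exact: (near_minimizer_orthogonal sM dP).
Qed.

Section Projection.
Variables (M : set H) (Mcl : closed_subspace M).
Let sM : submod_closed [in M] := Mcl.1.
Let P := orthoproj M.

Let orthoprojP x : M (P x) /\ orthocompl M (x - P x).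
Proof. exact: (xgetPex 0 (projection_theorem x Mcl)). Qed.

Lemma orthoproj_in x : M (orthoproj M x).
Proof. by case: (orthoprojP x). Qed.

Lemma orthoproj_residual x : orthocompl M (x - orthoproj M x).
Proof. by case: (orthoprojP x). Qed.

(** The difference of two candidates lies in M and is orthogonal to M. *)
Lemma orthoproj_unique x p : M p -> orthocompl M (x - p) -> orthoproj M x = p.
Proof.
move=> Mp xp; have [MPx xPx] := orthoprojP x.
have Md : M (P x - p).
  by rewrite addrC -scaleN1r; apply: submod_lin.
have qE : P x - p = (x - p) - (x - P x).
  by rewrite opprB [RHS]addrC addrA subrK.
have q0 : inner (P x - p) (P x - p) = 0.
  by rewrite {1}qE linearBl /= (xp _ Md) (xPx _ Md) subrr.
by apply/eqP; rewrite -subr_eq0 -(dnorm_eq0 (@inner R H)) q0.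
Qed.

Lemma orthoproj_linear : linear (orthoproj M).
Proof.
move=> a u v; apply: orthoproj_unique.
  by apply: submod_lin => //; exact: orthoproj_in.
have -> : a *: u + v - (a *: orthoproj M u + orthoproj M v) =
          a *: (u - orthoproj M u) + (v - orthoproj M v).
  by rewrite opprD addrACA scalerBr.
by apply: (submod_lin (submod_orthocompl M)); exact: orthoproj_residual.
Qed.

Lemma orthoproj_id x : M x -> orthoproj M x = x.
Proof.
by move=> Mx; apply: orthoproj_unique => // z _; rewrite subrr linear0l.
Qed.

Lemma orthoproj_eq0 x : orthocompl M x -> orthoproj M x = 0.
Proof.
move=> Mx; apply: orthoproj_unique; last by rewrite subr0.
exact: submod0.
Qed.

(** Both sides equal <P x, P y>. *)
Lemma orthoproj_selfadjoint x y :
  inner (orthoproj M x) y = inner x (orthoproj M y).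
Proof.
have [MPx xPx] := orthoprojP x; have [MPy yPy] := orthoprojP y.
have xy : inner x (P y) = inner (P x) (P y).
  by apply/eqP; have := xPx _ MPy; rewrite linearBl /= => /eqP; rewrite subr_eq0.
have yx : inner y (P x) = inner (P y) (P x).
  by apply/eqP; have := yPy _ MPx; rewrite linearBl /= => /eqP; rewrite subr_eq0.
by rewrite xy innerC yx -innerC.
Qed.

End Projection.

Definition complement (P : H -> H) : H -> H := fun x => x - P x.

Lemma complement_linear (P : H -> H) : linear P -> linear (complement P).
Proof.
by move=> P_lin a u v; rewrite /complement P_lin scalerBr opprD addrACA.
Qed.

Lemma complement_selfadjoint (P : H -> H) :
  (forall x y, inner (P x) y = inner x (P y)) ->
  forall x y, inner (complement P x) y = inner x (complement P y).
Proof. by move=> P_sa x y; rewrite linearBl linearBr /= P_sa. Qed.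

(** * Riesz representation *)

(** For z orthogonal to ker f, the vector f z *: x - f x *: z lies in ker f, so
    that f z * <x, z> = f x * |z|^2; solving for f x gives the representing
    vector. *)
Lemma riesz (f : H -> R[i]) :
    scalar f -> (exists2 c, 0 <= c & forall x, `|f x| <= c * `|x|) ->
  exists y, forall x, f x = inner x y.
Proof.
move=> f_lin [c c0 f_le].
pose K := [set x | f x = 0].
have f0 : f 0 = 0 by have := f_lin (-1) 0 0; rewrite scaler0 addr0 mulN1r addNr.
have fB u v : f (u - v) = f u - f v.
  by rewrite addrC -scaleN1r f_lin mulN1r addrC.
have fZ a u : f (a *: u) = a * f u by rewrite -[a *: u]addr0 f_lin f0 addr0.
(* c itself may be 0, which rules out dividing by it. *)
have c1 : 0 < c + 1 by rewrite ltr_wpDl.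
have K_closed : closed_subspace K.
  split.
    split=> [|a u v]; rewrite !in_setE // /K /= => fu fv.
    by rewrite f_lin fu fv mulr0 addr0.
  move=> x clx; apply/eqP; rewrite -normr_le0; apply/ler_addgt0Pr => e e0.
  have [z [fz]] := clx _ (nbhsx_ballx x _ (divr_gt0 e0 c1)).
  rewrite -ball_normE /= ltr_pdivlMr // => xz; rewrite add0r.
  have := f_le (x - z); rewrite fB fz subr0 => /le_trans; apply.
  by apply: le_trans (ltW xz); rewrite mulrC ler_wpM2l // lerDl.
have [f_eq0|] := pselect (forall x, f x = 0).
  by exists 0 => x; rewrite linear0r.
move=> /existsNP[x0 /eqP fx0].
pose z := x0 - orthoproj K x0.
have fz : f z != 0 by rewrite /z fB (orthoproj_in K_closed x0) subr0.
have z0 : z != 0 by apply: contraNneq fz => ->; rewrite f0.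
exists ((f z)^* / `|z| ^+ 2 *: z) => x.
have zK : orthocompl K z := orthoproj_residual K_closed x0.
have : inner z (f z *: x - f x *: z) = 0.
  by apply: zK; rewrite /K /= fB !fZ [f x * _]mulrC subrr.
rewrite innerC => /eqP; rewrite conjC_eq0 linearBl !linearZl_LR /= subr_eq0.
rewrite -inner_norm.
have nz : `|z| ^+ 2 != 0 by rewrite expf_neq0 ?normr_eq0.
move=> /eqP eq_fx; apply: (mulIf nz); rewrite -eq_fx.
rewrite linearZr_LR /= rmorphM /= conjCK.
have Nr : (`|z| ^+ 2)^* = `|z| ^+ 2 by apply/CrealP; rewrite realX ?normr_real.
by rewrite fmorphV /= Nr [RHS]mulrAC divfK.
Qed.

(** * Finite sums of rank-one operators *)

Lemma sum_rank_oneE n (a b : 'I_n -> H) h :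
  (\sum_(i < n) (a i \otimes b i)) h = \sum_(i < n) inner h (b i) *: a i.
Proof. by rewrite fct_sumE. Qed.

Lemma sum_rank_one_eq0 n (u v : 'I_n -> H) h :
  (forall i, inner h (v i) = 0) -> (\sum_(i < n) (u i \otimes v i)) h = 0.
Proof.
by move=> hv; rewrite sum_rank_oneE big1 // => i _; rewrite hv scale0r.
Qed.

(** Composing with B on the right acts on the right factors, because
    <B h, b> = <h, B b>. *)
Lemma sum_rank_one_comp n (a b : 'I_n -> H) (A : {linear H -> H}) B h :
  (forall x y, inner (B x) y = inner x (B y)) ->
  (\sum_(i < n) (A (a i) \otimes B (b i))) h =
  A ((\sum_(i < n) (a i \otimes b i)) (B h)).
Proof.
move=> B_sa; rewrite !sum_rank_oneE linear_sum; apply: eq_bigr => i _.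
by rewrite linearZ B_sa.
Qed.

(** Let e be the last spanning vector.  The coefficient f of the projection of
    S x onto the line through e is a bounded functional, hence given by some y,
    and S - e (x) y takes its values in the span of the other vectors corrected
    by their own projections onto that line. *)
Lemma span_sum_rank_one n (w : 'I_n -> H) (S : H -> H) :
    linear S -> (exists2 c, 0 <= c & forall x, `|S x| <= c * `|x|) ->
    (forall x, exists c : 'I_n -> R[i], S x = \sum_(i < n) c i *: w i) ->
  exists k (a b : 'I_k -> H), S = \sum_(i < k) (a i \otimes b i) :> (H -> H).
Proof.
elim: n w S => [|n IHn] w S S_lin [c c0 S_le] S_span.
  exists 0%N, w, w; apply/funext => x.
  by have [d ->] := S_span x; rewrite sum_rank_oneE !big_ord0.
pose e := w ord_max; pose f x := inner (S x) e / `|e| ^+ 2.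
have f_lin : scalar f.
  by move=> a u v; rewrite /f S_lin linearPl /= mulrDl mulrA.
have f_le x : `|f x| <= c / `|e| * `|x|.
  rewrite normrM normfV (ger0_norm (exprn_ge0 _ _)) //.
  have [->|e0] := eqVneq e 0.
    by rewrite linear0r !normr0 invr0 mulr0 !mul0r.
  have ne : 0 < `|e| by rewrite normr_gt0.
  rewrite ler_pdivrMr ?exprn_gt0 // (le_trans (inner_le _ _)) //.
  have -> : c / `|e| * `|x| * `|e| ^+ 2 = c * `|x| * `|e|.
    by field; rewrite gt_eqF.
  by rewrite ler_wpM2r.
have [y fy] : exists y, forall x, f x = inner x y.
  by apply: riesz => //; exists (c / `|e|) => //; rewrite divr_ge0.
have fe_le x : `|f x *: e| <= c * `|x|.
  rewrite normrZ; have [->|e0] := eqVneq e 0; last first.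
    by rewrite -ler_pdivlMr ?normr_gt0 // mulrAC.
  by rewrite normr0 mulr0 mulr_ge0.
pose w' i := w (widen_ord (leqnSn n) i).
have [|||k [a [b Sab]]] := IHn
  (fun i => w' i - inner (w' i) e / `|e| ^+ 2 *: e) (fun x => S x - f x *: e).
- move=> a u v.
  by rewrite S_lin f_lin scalerDl opprD addrACA scalerBr scalerA.
- exists (c + c) => [|x]; first by rewrite addr_ge0.
  by rewrite (le_trans (ler_normB _ _)) // mulrDl lerD.
- move=> x; have [d Sx] := S_span x.
  exists (fun i => d (widen_ord (leqnSn n) i)).
  (* Subtracting the projections cancels the term in e, also when e = 0. *)
  have eE : (inner e e / `|e| ^+ 2) *: e = e.
    have [->|e0] := eqVneq e 0; first by rewrite scaler0.
    by rewrite -inner_norm divff ?scale1r // expf_neq0 ?normr_eq0.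
  rewrite /f Sx big_ord_recr /= -/e linearDl linearZl_LR /= linear_sumlz.
  rewrite mulrDl scalerDl -mulrA -(scalerA (d ord_max)) eE.
  rewrite opprD addrACA subrr addr0.
  rewrite mulr_suml scaler_suml -sumrB; apply: eq_bigr => i _.
  by rewrite scalerBr scalerA linearZl_LR /= mulrA.
exists k.+1, (fun i => if unlift ord_max i is Some j then a j else e),
  (fun i => if unlift ord_max i is Some j then b j else y).
apply/funext => x; rewrite sum_rank_oneE big_ord_recr /= unlift_none -fy.
apply/eqP; rewrite -subr_eq; apply/eqP; have /(congr1 (@^~ x)) /= -> := Sab.
rewrite sum_rank_oneE; apply: eq_bigr => i _.
have -> : widen_ord (leqnSn k) i = lift ord_max i.
  by apply/val_inj; rewrite /= /bump leqNgt ltn_ord.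
by rewrite liftK.
Qed.

Lemma finite_rank_sum (S : {linear H -> H}) :
    bounded_operator S -> finite_rank S ->
  exists n (a b : 'I_n -> H), S = \sum_(i < n) (a i \otimes b i) :> (H -> H).
Proof.
move=> /linear_boundedP/pinfty_ex_gt0[c c0 S_le] [n [w Sw]].
apply: (@span_sum_rank_one n w); first exact: linearP.
  by exists c => //; exact: ltW.
move=> x; have : range S (S x) by exists x.
by rewrite Sw => -[d _ <-]; exists d.
Qed.

End HilbertTheory.

(** * Perturbations that make a subspace invariant or reducing *)

Theorem theorem5p4 (R : realType) (H : hilbertType R) (T : {linear H -> H})
    (T_bounded : bounded_operator T) (M : set H) (M_closed : closed_subspace M) :
  let P := orthoproj M in
  let I : H -> H := idfun in
  (almost_invariant T M ->
   forall T0 : {linear H -> H}, bounded_operator T0 -> finite_rank T0 ->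
   (invariant_subspace (T \+ T0) M <->
    exists (k m : nat) (x y : 'I_k -> H) (u v : 'I_m -> H),
      [/\ forall i, M (x i),
          forall j, orthocompl M (v j) &
          T0 = - ((I - P) \o T \o P)
               + \sum_(i < k) (x i \otimes y i)
               + \sum_(j < m) (u j \otimes v j) :> (H -> H)]))
  /\
  (almost_reducing T M ->
   forall T0 : {linear H -> H}, bounded_operator T0 -> finite_rank T0 ->
   (reducing_subspace (T \+ T0) M <->
    exists (k m : nat) (x y : 'I_k -> H) (u v : 'I_m -> H),
      [/\ forall i, M (x i) /\ M (y i),
          forall j, orthocompl M (u j) /\ orthocompl M (v j) &
          T0 = - ((I - P) \o T \o P) - (P \o T \o (I - P))
               + \sum_(i < k) (x i \otimes y i)
               + \sum_(j < m) (u j \otimes v j) :> (H -> H)])).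
Proof.
move=> P I.
have P_lin := orthoproj_linear M_closed; pose Q := complement P.
pose PL : {linear H -> H} := HB.pack P (GRing.isLinear.Build _ _ _ _ P P_lin).
pose QL : {linear H -> H} :=
  HB.pack Q (GRing.isLinear.Build _ _ _ _ Q (complement_linear P_lin)).
have PD u v : P (u + v) = P u + P v := linearD PL u v.
have QD u v : Q (u + v) = Q u + Q v := linearD QL u v.
have P0 : P 0 = 0 := linear0 PL.
have P_sa := orthoproj_selfadjoint M_closed.
have Q_sa := complement_selfadjoint P_sa.
have MP x : M (P x) := orthoproj_in M_closed x.
have MQ x : orthocompl M (Q x) := orthoproj_residual M_closed x.
have PDQ x : x = P x + Q x by rewrite addrC subrK.
have P_id x : M x -> P x = x := @orthoproj_id _ _ _ M_closed x.
have P_eq0 x : orthocompl M x -> P x = 0 := @orthoproj_eq0 _ _ _ M_closed x.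
have Q_eq0 x : M x -> Q x = 0.
  by move=> Mx; rewrite /Q /complement P_id // subrr.
have sM := M_closed.1; have sM' := submod_orthocompl M.
have lower_block (S : {linear H -> H}) h :
    invariant_subspace (T \+ S) M -> Q (S (P h)) = - Q (T (P h)).
  move=> inv; apply/eqP; rewrite -addr_eq0 addrC -QD; apply/eqP.
  by apply: Q_eq0; apply: inv; exists (P h).
have upper_block (S : {linear H -> H}) h :
    invariant_subspace (T \+ S) (orthocompl M) -> P (S (Q h)) = - P (T (Q h)).
  move=> inv; apply/eqP; rewrite -addr_eq0 addrC -PD; apply/eqP.
  by apply: P_eq0; apply: inv; exists (Q h).
split=> _ T0 T0_bounded T0_finite; split.
- move=> inv; have [n [a [b T0E]]] := finite_rank_sum T0_bounded T0_finite.
  (* In T0 = P T0 + Q T0 P + Q T0 Q the middle term is determined by T, and the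
     outer two are the two families. *)
  exists n, n, (P \o a), b, (Q \o a), (Q \o b).
  split=> [i|j|]; [exact: MP|exact: MQ|apply/funext => h; rewrite !fctE].
  have /= -> := sum_rank_one_comp a b PL (B := id) h (fun _ _ => erefl).
  have /= -> := sum_rank_one_comp a b QL h Q_sa.
  rewrite -T0E [LHS]PDQ addrAC addrC; congr (_ + _).
  rewrite -[I (T (P h)) - _]/(Q (T (P h))) -(lower_block T0) //.
  by rewrite -QD -(linearD T0) /= -PDQ.
- move=> [k [m [x [y [u [v [Mx Mv T0E]]]]]]] _ [h Mh <-].
  rewrite /= T0E !fctE /= P_id //.
  rewrite (sum_rank_one_eq0 u (fun j => orthocomplC (Mv j) Mh)).
  rewrite addr0 addrA opprB addrCA subrr addr0.
  by apply: submodD => //; rewrite sum_rank_oneE; exact: submod_sum.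
- move=> [inv inv'].
  have [n [a [b T0E]]] := finite_rank_sum T0_bounded T0_finite.
  (* The diagonal blocks P T0 P and Q T0 Q are the two families. *)
  exists n, n, (P \o a), (P \o b), (Q \o a), (Q \o b).
  split=> [i|j|]; first by split; exact: MP.
    by split; exact: MQ.
  apply/funext => h; rewrite !fctE.
  have /= -> := sum_rank_one_comp a b PL h P_sa.
  have /= -> := sum_rank_one_comp a b QL h Q_sa.
  rewrite -T0E -[I (T (P h)) - _]/(Q (T (P h))) -[I h - _]/(Q h).
  rewrite -(lower_block T0) // -(upper_block T0) //.
  rewrite {1}(PDQ h) (linearD T0) [LHS]PDQ PD QD addrA.
  by congr (_ + _); rewrite -addrA [RHS]addrC; congr (_ + _); rewrite addrC.
- move=> [k [m [x [y [u [v [Mxy Muv T0E]]]]]]].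
  split=> _ [h Mh <-]; rewrite /= T0E !fctE /=.
    rewrite P_id // subrr (linear0 T) P0 subr0.
    rewrite (sum_rank_one_eq0 u (fun j => orthocomplC (Muv j).2 Mh)).
    rewrite addr0 addrA opprB addrCA subrr addr0.
    apply: submodD => //; rewrite sum_rank_oneE.
    by apply: submod_sum => // i; case: (Mxy i).
  rewrite (P_eq0 _ Mh) (linear0 T) P0 !subr0 oppr0 add0r.
  rewrite (sum_rank_one_eq0 x (fun i => Mh _ (Mxy i).2)) addr0 addrA.
  apply: (submodD sM'); first exact: MQ.
  by rewrite sum_rank_oneE; apply: (submod_sum _ sM') => j; case: (Muv j).
Qed.
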